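(* Let $q\in\mathbb{C}$, $q\neq 0$, $q$ not a root of unity, let $n\ge 0$ be an integer, and let $b,c\in\mathbb{C}$ be such that $bq^{j}\ne 1$ and $cq^{j}\neq 1$ for $1\le j\le n$. Let $p_n(\,\cdot\,;a,b,c\,|\,q)$ denote the continuous dual $q$-Hahn polynomial and $P_n(\,\cdot\,;b,c;q)$ the big $q$-Laguerre polynomial. Then for every $x\in\mathbb{C}$ $$\lim_{a\to 0} a^n\, p_n\big(\tfrac12 a^{-1}x;\,a,\,a^{-1}bq,\,a^{-1}cq\,|\,q\big)=(bq;q)_n\,(cq;q)_n\,P_n(x;b,c;q),$$ where $a\to0$ through nonzero values.
   Context: Notation: $(\beta;q)_k:=\prod_{j=0}^{k-1}(1-\beta q^j)$, and $(\beta_1,\ldots,\beta_s;q)_k:=(\beta_1;q)_k\cdots(\beta_s;q)_k$. For $a\ne0$ with $(ab,ac;q)_n\neq0$, the continuous dual $q$-Hahn polynomial is defined, with $x=z+z^{-1}$, by $$p_n\big(\tfrac12 x;a,b,c\,|\,q\big)=\frac{(ab,ac;q)_n}{a^n}\sum_{k=0}^n\frac{(q^{-n};q)_k\,(az;q)_k\,(az^{-1};q)_k}{(ab;q)_k\,(ac;q)_k\,(q;q)_k}\,q^k .$$ It is a polynomial in $x$, since $(az;q)_k(az^{-1};q)_k=\prod_{j=0}^{k-1}(1-axq^j+a^2q^{2j})$. The big $q$-Laguerre polynomial is defined by $$P_n(x;b,c;q)=\sum_{k=0}^n\frac{(q^{-n};q)_k\,(x;q)_k}{(bq;q)_k\,(cq;q)_k\,(q;q)_k}\,q^k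 .$$ *)

(* Defs.v *)
From mathcomp Require Import all_boot all_order all_algebra.
From mathcomp Require Import ring.

Set Implicit Arguments.
Unset Strict Implicit.
Unset Printing Implicit Defensive.

Import Order.TTheory GRing.Theory Num.Theory.

Local Open Scope ring_scope.

Section QPolynomials.
Variable C : numClosedFieldType.
Implicit Types a b c q x y z : C.

Definition qpoch (beta q : C) (k : nat) : C :=
  \prod_(j < k) (1 - beta * q ^+ j).

(* Continuous dual q-Hahn polynomial in the variable z, where the argument of
   the polynomial is (z + z^-1) / 2. *)
Definition cdqHahn_z (n : nat) z a b c q : C :=
  qpoch (a * b) q n * qpoch (a * c) q n / a ^+ n *
  \sum_(k < n.+1)
     (qpoch (q ^- n) q k * qpoch (a * z) q k * qpoch (a * z^-1) q k) /
     (qpoch (a * b) q k * qpoch (a * c) q k * qpoch q q k) * q ^+ k.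

(* A solution z of (z + z^-1) / 2 = y; the other one is its inverse. *)
Definition joukowski_inv y : C := y + sqrtC (y ^+ 2 - 1).

Definition cdqHahn (n : nat) y a b c q : C :=
  cdqHahn_z n (joukowski_inv y) a b c q.

Definition bigqLaguerre (n : nat) x b c q : C :=
  \sum_(k < n.+1)
     (qpoch (q ^- n) q k * qpoch x q k) /
     (qpoch (b * q) q k * qpoch (c * q) q k * qpoch q q k) * q ^+ k.

Lemma cdqHahn_zV n z a b c q : cdqHahn_z n z^-1 a b c q = cdqHahn_z n z a b c q.
Proof.
rewrite /cdqHahn_z invrK; congr (_ * _); apply: eq_bigr => k _.
by congr (_ / _ * _); rewrite mulrAC.
Qed.

Lemma joukowski_inv_neq0 y : joukowski_inv y != 0.
Proof.
apply/eqP => /eqP; rewrite /joukowski_inv addr_eq0 => /eqP e.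
have := sqrtCK (y ^+ 2 - 1).
rewrite -[sqrtC _]opprK -e sqrrN => /eqP.
by rewrite -subr_eq0 opprB addrC subrK oner_eq0.
Qed.

Lemma joukowski_invK y :
  (joukowski_inv y + (joukowski_inv y)^-1) / 2 = y.
Proof.
have w0 := joukowski_inv_neq0 y; set w := joukowski_inv y in w0 *.
have e : w ^+ 2 + 1 = 2 * y * w.
  have := sqrtCK (y ^+ 2 - 1); rewrite /w /joukowski_inv.
  by move: (sqrtC _) => s e; ring: e.
have n2 : (2 : C) != 0 by rewrite pnatr_eq0.
apply: (mulfI n2); apply: (mulfI w0).
transitivity (w ^+ 2 + 1); first by field.
by rewrite e; ring.
Qed.

(* The choice of z is immaterial. *)
Lemma cdqHahnE n z a b c q : z != 0 ->
  cdqHahn n ((z + z^-1) / 2) a b c q = cdqHahn_z n z a b c q.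
Proof.
move=> z0; rewrite /cdqHahn; set y := (z + _) / 2.
have w0 := joukowski_inv_neq0 y; have := joukowski_invK y.
move: (joukowski_inv y) w0 => w w0.
have n2 : (2 : C) != 0 by rewrite pnatr_eq0.
move=> /(congr1 ( *%R^~ 2)); rewrite /y !mulfVK // => e.
have : (w - z) * (w - z^-1) = 0.
  transitivity (w * (w + w^-1) - w * (z + z^-1)); first by field; rewrite w0 z0.
  by rewrite e subrr.
move/eqP; rewrite mulf_eq0 !subr_eq0 => /orP[] /eqP -> //.
exact: cdqHahn_zV.
Qed.

End QPolynomials.

(* Main.v *)
(* With x / a = z + 1/z, the factors (1 - a z q^j) (1 - a z^-1 q^j) of the summands equal
   1 - x q^j + a^2 q^(2j), and the parameters satisfy a (a^-1 b q) = b q. Hence for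
   a <> 0 the function under the limit is a polynomial in a, whose value at a = 0 is the
   right-hand side. *)
Require Import Defs.
From mathcomp Require Import all_boot all_order all_algebra.
From mathcomp Require Import all_classical all_reals topology normedtype.
From mathcomp Require Import complex.
From mathcomp Require Import ring.
Import Order.TTheory GRing.Theory Num.Theory.
Import numFieldNormedType.Exports.
Local Open Scope classical_set_scope.
Local Open Scope ring_scope.
Local Open Scope complex_scope.

Lemma qpoch_mul_pair (C : numClosedFieldType) (a z x q : C) (k : nat) :
  z != 0 -> a * (z + z^-1) = x ->
  qpoch (a * z) q k * qpoch (a * z^-1) q k =
  \prod_(j < k) (1 - x * q ^+ j + a ^+ 2 * q ^+ j ^+ 2).
Proof.
move=> z0 <-; rewrite /qpoch -big_split; apply: eq_bigr => j _ /=.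
by field.
Qed.

(** The prefactor [a ^+ n] cancels the [a ^- n] of the definition, and each summand depends on [z]
    only through [z + z^-1], so the square root chosen in [joukowski_inv] disappears. *)
Lemma cdqHahn_rescaled (C : numClosedFieldType) (n : nat) (q b c x a : C) :
  a != 0 ->
  a ^+ n * cdqHahn n (2^-1 * a^-1 * x) a (a^-1 * b * q) (a^-1 * c * q) q =
  qpoch (b * q) q n * qpoch (c * q) q n *
  \sum_(k < n.+1)
     (qpoch (q ^- n) q k *
      \prod_(j < k) (1 - x * q ^+ j + a ^+ 2 * q ^+ j ^+ 2)) /
     (qpoch (b * q) q k * qpoch (c * q) q k * qpoch q q k) * q ^+ k.
Proof.
move=> a0; rewrite /cdqHahn /cdqHahn_z.
set y := _ * x; have w0 := joukowski_inv_neq0 y; have wK := joukowski_invK y.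
have aK d : a * (a^-1 * d * q) = d * q by rewrite !mulrA divff // mul1r.
have n2 : (2 : C) != 0 by rewrite pnatr_eq0.
(* Here [y = x / (2 a)], so [z + z^-1 = 2 y = x / a]. *)
have aw : a * (joukowski_inv y + (joukowski_inv y)^-1) = x.
  have -> : joukowski_inv y + (joukowski_inv y)^-1 = 2 * y by rewrite -{3}wK mulrC divfK.
  by rewrite /y; field; rewrite a0.
rewrite !aK mulrA (mulrC (a ^+ n)) divfK ?expf_neq0 //; congr (_ * _).
apply: eq_bigr => k _; congr (_ / _ * _).
by rewrite -mulrA (qpoch_mul_pair _ _ _ _ q k w0 aw).
Qed.

(** Induction along Horner's scheme: [p * 'X + r%:P] evaluates to a product plus a constant, and
    both operations preserve limits. *)
Lemma continuous_horner_numField (F : numFieldType) (p : {poly F}) :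
  continuous (fun a : F^o => p.[a] : F^o).
Proof.
elim/poly_ind: p => [|p r IHp].
  rewrite (_ : (fun _ => _) = cst (0 : F^o)); first exact: cst_continuous.
  by apply/funext => y; rewrite horner0.
rewrite (_ : (fun _ => _) = (fun y : F^o => p.[y] * y + r : F^o)).
  move=> a; apply: (cvgD _ (@cst_continuous _ F^o r a)).
  by apply: cvgM; [exact: IHp | exact: cvg_id].
by apply/funext => y; rewrite hornerMXaddC.
Qed.

Theorem mainTheorem1 (R : realType) (q : R[i]) (n : nat) (b c : R[i])
  (q_neq0 : q != 0)
  (q_not_root_of_unity : forall k : nat, (0 < k)%N -> q ^+ k != 1)
  (b_neq : forall j : nat, (1 <= j <= n)%N -> b * q ^+ j != 1)
  (c_neq : forall j : nat, (1 <= j <= n)%N -> c * q ^+ j != 1)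
  (x : R[i]) :
  (fun a : R[i] =>
     a ^+ n * cdqHahn n (2^-1 * a^-1 * x) a (a^-1 * b * q) (a^-1 * c * q) q)
    @ (0 : R[i]^o)^' -->
  (qpoch (b * q) q n * qpoch (c * q) q n * bigqLaguerre n x b c q : R[i]^o).
Proof.
(* The polynomial in [a]: the denominators are free of [a], so their inverses enter as constant
   coefficients. *)
pose p : {poly R[i]} := (qpoch (b * q) q n * qpoch (c * q) q n)%:P *
  \sum_(k < n.+1)
     ((qpoch (q ^- n) q k)%:P *
      \prod_(j < k) ((1 - x * q ^+ j)%:P + 'X ^+ 2 * (q ^+ j ^+ 2)%:P)) *
     (qpoch (b * q) q k * qpoch (c * q) q k * qpoch q q k)^-1%:P * (q ^+ k)%:P.
have pE a : p.[a] = qpoch (b * q) q n * qpoch (c * q) q n *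
  \sum_(k < n.+1)
     (qpoch (q ^- n) q k *
      \prod_(j < k) (1 - x * q ^+ j + a ^+ 2 * q ^+ j ^+ 2)) /
     (qpoch (b * q) q k * qpoch (c * q) q k * qpoch q q k) * q ^+ k.
  rewrite /p hornerM hornerC horner_sum; congr (_ * _); apply: eq_bigr => k _.
  rewrite !(hornerM, hornerC) horner_prod; congr (_ * _ * _ * _).
  by apply: eq_bigr => j _; rewrite hornerD hornerM horner_exp hornerX !hornerC.
(* At [a = 0] the quadratic term drops out and the product over [j < k] becomes [qpoch x q k]. *)
have -> : qpoch (b * q) q n * qpoch (c * q) q n * bigqLaguerre n x b c q = p.[0].
  rewrite pE; congr (_ * _); apply: eq_bigr => k _; congr (_ * _ / _ * _).
  by apply: eq_bigr => j _; rewrite expr0n mul0r addr0.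
(* Continuity of [p] at 0 gives the limit along all neighbourhoods of 0, hence along the finer
   punctured filter. There [a != 0] holds eventually, which is what [cdqHahn_rescaled] requires to
   replace [p] by the given function. *)
apply: cvg_trans
  (cvg_trans (cvg_app _ (@nbhs_dnbhs _ _)) (continuous_horner_numField _ p 0)).
apply: near_eq_cvg; near=> a; rewrite pE; apply/esym/cdqHahn_rescaled.
by near: a; exact: (@nbhs_dnbhs_neq R[i]^o).
Unshelve. all: by end_near.
Qed.
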